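(* Let $M=(m_{pq})$ be a reduced $n\times n$ matrix with nonnegative integer entries. Then $\mathrm{Cat}(M)\neq\emptyset$ if and only if $M$ is acceptable and, with the partition of the indices into classes $\lambda,\mu,\dots$ of type $U$ or $V$ and the notation $\lambda^i$, $a$, $b$ described in the context, all the following inequalities hold: 1. $M(\lambda^i,\lambda^i)\ge a(\lambda^i)\,b(\lambda^i)+1$ for every class $\lambda\in U$ and every $i\ge 1$; 2. $M(\lambda^i,\lambda^j)\ge a(\lambda^i)\,b(\lambda^j)$ for every class $\lambda\in U$ and all $i,j$; 3. $M(\lambda^i,\mu^j)\ge M(\lambda^i,\mu^0)$ for all classes $\lambda>\mu$ with $\mu\in U$, and all $i,j$; 4. $M(\lambda^i,\mu^j)\ge M(\lambda^0,\mu^j)$ for all classes $\lambda>\mu$ with $\lambda\in U$, and all $i,j$; 5. $M(\lambda^i,\mu^j)\ge M(\lambda^0,\mu^j)+M(\lambda^i,\mu^0)-M(\lambda^0,\mu^0)$ for all classes $\lambda\ge\mu$ with $\lambda,\mu\in U$, and all $i,j$.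
   Context: A category $A$ is associated to an $n\times n$ matrix $M=(m_{pq})$ of nonnegative integers if $A$ has exactly $n$ (distinct) objects $x_1,\dots,x_n$ and, for all $p,q$, the set $A(x_p,x_q)$ of morphisms $x_p\to x_q$ has exactly $m_{pq}$ elements. $\mathrm{Cat}(M)$ denotes the collection of categories associated to $M$; so $\mathrm{Cat}(M)\ne\emptyset$ means that at least one such category exists. $M$ is non-reduced if there are indices $p\ne q$ such that $m_{kp}=m_{kq}$ and $m_{pk}=m_{qk}$ for all $k$; $M$ is reduced if it is not non-reduced. Define a relation on the index set $\{1,\dots,n\}$ by $p\ge q$ if and only if $m_{pq}\ge 1$. $M$ is acceptable if this relation is reflexive and transitive. When $M$ is acceptable, $p\sim q$ (meaning $m_{pq}>0$ and $m_{qp}>0$) is an equivalence relation; its equivalence classes are denoted $\lambda,\mu,\dots$. A class is of type $U$ (written $\lambda\in U$) if it contains at least one index $p$ with $m_{pp}=1$; otherwise it is of type $V$ (so $m_{pp}\ge 2$ for all $p$ in the class). The elements of a class $\lambda$ are written $\lambda^i$: with $0\le i<|\lambda|$ if $\lambda\in U$, where $\lambda^0$ is a chosen index with diagonal entry equal to $1$; and with $1\le i\le|\lambda|$ if $\lambda\in V$. The entry of $M$ in row $\lambda^i$ and column $\mu^j$ is written $M(\lambda^i,\mu^j)$. For $\lambda\in U$ put $a(\lambda^i):=M(\lambda^i,\lambda^0)$ and $b(\lambda^j):=M(\lambda^0,\lambda^j)$. For classes $\lambda,\mu$, write $\lambda\ge\mu$ if $M(\lambda^i,\mu^j)\ge 1$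 for some (equivalently, all) $i,j$, and $\lambda>\mu$ if $\lambda\ge\mu$ and $\lambda\ne\mu$. In the inequalities, $i$ and $j$ range over all index values allowed for the classes concerned. *)

(* Defs.v *)
From HB Require Import structures.
From mathcomp Require Import all_boot all_order all_algebra.

Set Implicit Arguments.
Unset Strict Implicit.
Unset Printing Implicit Defensive.

Record category := Category {
  obj : Type;
  hom : obj -> obj -> Type;
  idm : forall x, hom x x;
  (* diagrammatic order: [comp f g] is "f, then g" *)
  comp : forall x y z, hom x y -> hom y z -> hom x z;
  comp_idl : forall x y (f : hom x y), comp (idm x) f = f;
  comp_idr : forall x y (f : hom x y), comp f (idm y) = f;
  compA : forall x y z t (f : hom x y) (g : hom y z) (h : hom z t),
    comp f (comp g h) = comp (comp f g) h
}.

Definition associated n (C : category) (M : 'M[nat]_n) : Prop :=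
  exists x : 'I_n -> obj C,
    bijective x /\
    forall p q, exists e : 'I_(M p q) -> hom (x p) (x q), bijective e.

Definition Cat_nonempty n (M : 'M[nat]_n) : Prop :=
  exists C : category, associated C M.

Definition non_reduced n (M : 'M[nat]_n) : Prop :=
  exists p q : 'I_n,
    p <> q /\ forall k : 'I_n, M k p = M k q /\ M p k = M q k.

Definition reduced n (M : 'M[nat]_n) : Prop := ~ non_reduced M.

Definition index_ge n (M : 'M[nat]_n) : rel 'I_n := fun p q => 1 <= M p q.

Definition acceptable n (M : 'M[nat]_n) : Prop :=
  reflexive (index_ge M) /\ transitive (index_ge M).

Definition index_sim n (M : 'M[nat]_n) : rel 'I_n :=
  fun p q => (0 < M p q) && (0 < M q p).

(* These are the equivalence classes of [index_sim M] when M is acceptable;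
   for other M the type is still defined, but carries no meaning. *)
Definition mclass n (M : 'M[nat]_n) : Type :=
  {l : {set 'I_n} | l \in equivalence_partition (index_sim M) [set: 'I_n]}.

(* The classes of type V are those not of type U. *)
Definition typeU n (M : 'M[nat]_n) (l : mclass M) : bool :=
  [exists p in sval l, M p p == 1].

Definition class_ge n (M : 'M[nat]_n) (l m : mclass M) : Prop :=
  exists i j : 'I_n, [/\ i \in sval l, j \in sval m & 1 <= M i j].

Definition class_gt n (M : 'M[nat]_n) (l m : mclass M) : Prop :=
  class_ge l m /\ l <> m.

(* [z l] is the chosen index l^0 of a class l of type U; its value on classes
   of type V is irrelevant. The elements l^i of a class are represented by the
   indices i \in sval l themselves, so that "i >= 1" reads i <> z l. *)
Definition base_points n (M : 'M[nat]_n) (z : mclass M -> 'I_n) : Prop :=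
  forall l : mclass M, typeU l -> z l \in sval l /\ M (z l) (z l) = 1.

Definition a n (M : 'M[nat]_n) (z : mclass M -> 'I_n) (l : mclass M)
  (i : 'I_n) : nat := M i (z l).

Definition b n (M : 'M[nat]_n) (z : mclass M -> 'I_n) (l : mclass M)
  (j : 'I_n) : nat := M (z l) j.

(* Main.v *)
Require Import Defs.
From HB Require Import structures.
From mathcomp Require Import all_boot all_order all_algebra.
From mathcomp Require Import zify.

Set Implicit Arguments.
Unset Strict Implicit.
Unset Printing Implicit Defensive.

(** Necessity. If an object z has a single endomorphism, every object of its
    class retracts onto z: any composite z -> j -> z must be the identity.
    Composing with the two halves of a retraction is therefore injective on
    hom-sets, which gives the comparisons with the column and the row of a base
    object ([retract_col], [retract_row]). Inside the class, a morphism i -> j that factors through z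
    determines both factors ([factor_count]); when i = j the identity is not
    such a morphism, for otherwise i and z would be isomorphic and M would have
    equal rows and columns ([factor_count_endo]). This gives the
    products. If z and w are the base objects of the classes of i and j, the
    images of A(z, j) and A(i, w) in A(i, j) meet exactly in the image of
    A(z, w), and the last inequality bounds the size of their union
    ([retract_union_count]).

    Sufficiency. Add to each class of type V a virtual base object with one
    endomorphism and with exactly one morphism to or from any object that it is
    related to; the inequalities survive, so that every class may be treated as
    one of type U and the virtual objects forgotten afterwards. It remains to
    compose morphisms in the most degenerate way which respects the base
    objects. Let i, j be objects whose classes have base objects z, w.
    - If i and j are in the same class, A(i, j) contains A(i, z) x A(z, j); all
      remaining non-identity morphisms behave like one fixed pair. Non-identity
      morphisms compose by (f, g)(f', g') = (f, g').
    - If the class of i is strictly above that of j, A(i, j) contains A(z, j)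
      and A(i, w) glued along A(z, w); composing with any non-identity morphism
      inside the class of i or of j is the retraction onto the first, resp.
      second, part, followed by the inclusion into the target hom-set. The two
      retractions commute.
    - Two morphisms that both pass strictly from a class to a lower one compose
      to a fixed element of the glued part.
    A hom-set with m elements is encoded by the numbers below m, the composition
    becomes a piecewise affine function of codes, and its associativity is
    [comp_nonidA], a case distinction on which of the three
    morphisms change class. *)

(** * Categories as compositions on ordinals *)

(** A category associated to M, with its hom-sets transported to ordinals
    and its objects renamed to the indices themselves. *)
Record mxcat n (M : 'M[nat]_n) := Mxcat {
  mid : forall p, 'I_(M p p);
  mcomp : forall p q r, 'I_(M p q) -> 'I_(M q r) -> 'I_(M p r);
  mcomp_idl : forall p q (f : 'I_(M p q)), mcomp (mid p) f = f;
  mcomp_idr : forall p q (f : 'I_(M p q)), mcomp f (mid q) = f;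
  mcompA : forall p q r s (f : 'I_(M p q)) (g : 'I_(M q r)) (h : 'I_(M r s)),
    mcomp f (mcomp g h) = mcomp (mcomp f g) h
}.

Lemma Cat_nonempty_mxcat n (M : 'M[nat]_n) :
  Cat_nonempty M <-> inhabited (mxcat M).
Proof.
split=> [[A [x [_ homP]]]|[A]]; last first.
  exists (Category (@mcomp_idl _ _ A) (@mcomp_idr _ _ A) (@mcompA _ _ A)), id.
  by split; [exists id | move=> p q; exists id; exists id].
have {homP} [d dP] : exists d : forall p q,
    ('I_(M p q) -> Defs.hom (x p) (x q)) * (Defs.hom (x p) (x q) -> 'I_(M p q)),
    forall p q, cancel (d p q).1 (d p q).2 /\ cancel (d p q).2 (d p q).1.
  apply: (@fin_all_exists _ _ (fun p d => forall q,
    cancel (d q).1 (d q).2 /\ cancel (d q).2 (d q).1)) => p.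
  apply: (@fin_all_exists _ _ (fun q d =>
    cancel d.1 d.2 /\ cancel d.2 d.1)) => q.
  by have [e [e' eK e'K]] := homP p q; exists (e, e').
have eK p q := (dP p q).1; have e'K p q := (dP p q).2.
constructor; apply: (@Mxcat _ _ (fun p => (d p p).2 (idm (x p)))
  (fun p q r f g => (d p r).2 (Defs.comp ((d p q).1 f) ((d q r).1 g)))).
- by move=> p q f; rewrite e'K comp_idl eK.
- by move=> p q f; rewrite e'K comp_idr eK.
- by move=> p q r s f g h; rewrite !e'K Defs.compA.
Qed.

(** * Similarity of indices and classes *)

Section Similarity.
Variables (n : nat) (M : 'M[nat]_n).
Local Notation sim := (index_sim M).

Lemma index_simC i j : sim i j = sim j i.
Proof. by rewrite /index_sim andbC. Qed.

Lemma class_of_subproof i : [set j in [set: 'I_n] | sim i j]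
  \in equivalence_partition sim [set: 'I_n].
Proof. by apply/imsetP; exists i; rewrite ?inE. Qed.

Definition class_of i : mclass M :=
  exist (fun l => l \in equivalence_partition sim [set: 'I_n]) _
    (class_of_subproof i).

Lemma mem_class_of i j : (j \in sval (class_of i)) = sim i j.
Proof. by rewrite !inE. Qed.

Hypothesis accM : acceptable M.

Lemma index_sim_refl i : sim i i.
Proof. by apply/andP; split; apply: accM.1. Qed.

Lemma M_trans i j k : 0 < M i j -> 0 < M j k -> 0 < M i k.
Proof. exact: accM.2. Qed.

(** A chain of two arrows can only return to the class where it started if it
    never left it: this is antisymmetry of the order on classes. *)
Lemma index_sim_comp i j k :
  0 < M i j -> 0 < M j k -> sim i k = sim i j && sim j k.
Proof.
move=> Mij Mjk; rewrite /index_sim Mij Mjk (M_trans Mij Mjk) /=.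
apply/idP/andP => [Mki|[Mji Mkj]]; last exact: M_trans Mkj Mji.
by rewrite (M_trans Mjk Mki) (M_trans Mki Mij).
Qed.

Lemma index_sim_trans : transitive sim.
Proof.
move=> j i k /andP[Mij Mji] /andP[Mjk Mkj].
by apply/andP; split; [exact: accM.2 Mij Mjk | exact: accM.2 Mkj Mji].
Qed.

Lemma class_of_sim i j : sim i j -> class_of i = class_of j.
Proof.
move=> ij; apply: val_inj; apply/setP=> k; rewrite !inE.
apply/idP/idP; apply: index_sim_trans => //.
by rewrite index_simC.
Qed.

Lemma sim_in_class (l : mclass M) i j :
  i \in sval l -> j \in sval l -> sim i j.
Proof.
case: l => /= l /imsetP[k _ ->]; rewrite !inE => ki kj.
by apply: index_sim_trans kj; rewrite index_simC.
Qed.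
End Similarity.

Arguments mem_class_of {n M} i j.

(** * Necessity of the inequalities *)

Section Necessity.
Variables (n : nat) (M : 'M[nat]_n) (A : mxcat M).
Implicit Types i j k z w : 'I_n.
Local Notation "f ** g" := (mcomp A f g) (at level 40, left associativity).

Lemma mxcat_acceptable : acceptable M.
Proof.
split=> [i|j i k]; rewrite /index_ge.
  exact: leq_ltn_trans (leq0n _) (ltn_ord (mid A i)).
move=> Mij Mjk.
exact: leq_ltn_trans (leq0n _) (ltn_ord (Ordinal Mij ** Ordinal Mjk)).
Qed.

Definition retract z j :=
  exists (s : 'I_(M z j)) (r : 'I_(M j z)), s ** r = mid A z.

Lemma endo1_id z (u : 'I_(M z z)) : M z z = 1 -> u = mid A z.
Proof.
move=> Mzz; apply: val_inj => /=.
by case: u (mid A z) => [u Hu] [v Hv] /=; rewrite Mzz in Hu Hv; lia.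
Qed.

Lemma endo1_retract z j : M z z = 1 -> index_sim M z j -> retract z j.
Proof.
move=> Mzz /andP[Mzj Mjz]; exists (Ordinal Mzj), (Ordinal Mjz).
exact: endo1_id.
Qed.

Lemma leq_hom (p q : nat) (f : 'I_p -> 'I_q) : injective f -> p <= q.
Proof. by move/leq_card; rewrite !card_ord. Qed.

Lemma retract_col z j k : retract z j -> M k z <= M k j.
Proof.
move=> [s [r sr]]; apply: (@leq_hom _ _ (fun f => f ** s)) => f g.
by move/(congr1 (fun h => h ** r)); rewrite -!mcompA sr !mcomp_idr.
Qed.

Lemma retract_row z j k : retract z j -> M z k <= M j k.
Proof.
move=> [s [r sr]]; apply: (@leq_hom _ _ (fun f => r ** f)) => f g.
by move/(congr1 (fun h => s ** h)); rewrite !mcompA sr !mcomp_idl.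
Qed.

(** Isomorphic objects are retracts of each other, so their rows and columns
    bound each other. *)
Lemma reduced_not_iso i z (f : 'I_(M i z)) (g : 'I_(M z i)) :
  reduced M -> i <> z -> f ** g = mid A i -> g ** f = mid A z -> False.
Proof.
move=> redM iz fg gf; apply: redM; exists i, z; split=> // k.
have ri : retract i z by exists f, g.
have rz : retract z i by exists g, f.
by split; apply/eqP; rewrite eqn_leq ?retract_col ?retract_row.
Qed.

(** Each factor is recovered by composing with a morphism which turns the other
    one into an endomorphism of z, that is, into the identity. *)
Lemma factor_inj z i j (f f' : 'I_(M i z)) (g g' : 'I_(M z j)) :
  M z z = 1 -> index_sim M z i -> index_sim M z j ->
  f ** g = f' ** g' -> f = f' /\ g = g'.
Proof.
move=> Mzz zi zj E.
have id1 (u : 'I_(M z z)) : u = mid A z := endo1_id u Mzz.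
have [s [_ _]] := endo1_retract Mzz zi.
have [_ [r _]] := endo1_retract Mzz zj.
split.
- have := congr1 (fun h => h ** r) E.
  by rewrite -!mcompA !(id1 (_ ** _)) !mcomp_idr.
- have := congr1 (fun h => s ** h) E.
  by rewrite !mcompA !(id1 (_ ** _)) !mcomp_idl.
Qed.

Lemma factor_count z i j :
  M z z = 1 -> index_sim M z i -> index_sim M z j -> M i z * M z j <= M i j.
Proof.
move=> Mzz zi zj.
pose h (u : 'I_(M i z) * 'I_(M z j)) := u.1 ** u.2.
suff /leq_card : injective h by rewrite card_prod !card_ord.
by move=> [f g] [f' g'] /(factor_inj Mzz zi zj)[/= -> ->].
Qed.

(** The additional morphism is the identity of i. *)
Lemma factor_count_endo z i : reduced M -> i <> z ->
  M z z = 1 -> index_sim M z i -> M i z * M z i + 1 <= M i i.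
Proof.
move=> redM iz Mzz zi.
pose h (o : option ('I_(M i z) * 'I_(M z i))) :=
  if o is Some u then u.1 ** u.2 else mid A i.
suff /leq_card : injective h by rewrite card_option card_prod !card_ord addn1.
have nofactor (f : 'I_(M i z)) (g : 'I_(M z i)) : f ** g = mid A i -> False.
  by move=> fg; apply: (reduced_not_iso redM iz fg); apply: endo1_id.
move=> [[f g]|] [[f' g']|] //=.
- by move/(factor_inj Mzz zi zi)=> [-> ->].
- by move/nofactor.
- by move/esym/nofactor.
Qed.

(** A morphism in both images, r u = v t, satisfies u = s r u = (s v) t with
    s v : z -> w, hence it is r (s v) t. *)
Lemma retract_union_count z i w j : retract z i -> retract w j ->
  M z j + M i w <= M i j + M z w.
Proof.
move=> [s [r sr]] [t [q tq]].
pose F := (fun u : 'I_(M z j) => r ** u) @: setT.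
pose G := (fun v : 'I_(M i w) => v ** t) @: setT.
pose H := (fun v : 'I_(M z w) => r ** v ** t) @: setT.
have cF : #|F| = M z j.
  rewrite card_imset ?cardsT ?card_ord // => u u'.
  by move/(congr1 (fun h => s ** h)); rewrite !mcompA sr !mcomp_idl.
have cG : #|G| = M i w.
  rewrite card_imset ?cardsT ?card_ord // => v v'.
  by move/(congr1 (fun h => h ** q)); rewrite -!mcompA tq !mcomp_idr.
have cH : #|H| <= M z w.
  by rewrite -[X in _ <= X]card_ord -cardsT leq_imset_card.
have sub : F :&: G \subset H.
  apply/subsetP=> h /setIP[/imsetP[u _ hu] /imsetP[v _ hv]].
  have uv : u = s ** v ** t.
    by rewrite -mcompA -hv hu mcompA sr mcomp_idl.
  by apply/imsetP; exists (s ** v); rewrite ?inE // hu uv !mcompA.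
have := cardsUI F G; have := subset_leq_card sub.
have := max_card (F :|: G); rewrite card_ord cF cG; lia.
Qed.
End Necessity.

(** * Composition of codes *)

Section Sufficiency.
Variables (n : nat) (M : 'M[nat]_n).
(* With z and w the possibly virtual base objects of the classes of i and j,
   the numbers P i j, Q i j and C i j are the sizes of A(z, j), A(i, w) and
   A(z, w); [base] holds of the indices that are base objects. *)
Variables (base : pred 'I_n) (P Q C : 'I_n -> 'I_n -> nat).
Implicit Types i j k l : 'I_n.
Local Notation sim := (index_sim M).

Hypothesis accM : acceptable M.
Hypothesis simP : forall i j k, sim i j -> P i k = P j k.
Hypothesis simQ : forall i j k, sim j k -> Q i j = Q i k.
Hypothesis simC1 : forall i j k, sim i j -> C i k = C j k.
Hypothesis simC2 : forall i j k, sim j k -> C i j = C i k.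
Hypothesis base1 : forall i, base i -> M i i = 1.
Hypothesis baseP : forall i k, base i -> P i k = M i k.
Hypothesis baseQ : forall i k, base k -> Q i k = M i k.
Hypothesis baseC : forall i k, base k -> C i k = P i k.
Hypothesis sim_gt0 : forall i j, sim i j -> 0 < P i j /\ 0 < Q i j.
Hypothesis sim_le : forall i j, sim i j -> Q i j * P i j <= M i j.
Hypothesis nbase_lt : forall i, ~~ base i -> Q i i * P i i < M i i.
Hypothesis strict_le : forall i j, 0 < M i j -> ~~ sim i j ->
  [/\ 0 < C i j, C i j <= P i j, C i j <= Q i j & P i j + Q i j <= M i j + C i j].

(** Inside a class, the code of a pair (f, g) in A(i, z) x A(z, j) is
    f * P i j + g; the codes from Q i j * P i j on are read as the pair (0, 0),
    except the one that encodes the identity, see [is_id]. *)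
Definition fst_code i j x := if x < Q i j * P i j then x %/ P i j else 0.
Definition snd_code i j x := if x < Q i j * P i j then x %% P i j else 0.

(** Let j be strictly above k, and let z, w be the base objects of their classes.
    In A(j, k) the codes below C j k are those of A(z, w), the codes from C j k on
    and below P j k complete them to A(z, k), the next Q j k - C j k codes
    complete them to A(j, w), and the other codes belong to neither. Composing on
    the left with a non-identity i -> j in the class of j retracts onto A(z, k),
    whose codes are the same in row i as in row j. *)
Definition act_left j k y := if y < P j k then y else 0.

(** Dually, with w the base object of the common class of j and k, this retracts
    A(i, j) onto A(i, w) and includes the latter in A(i, k); the part outside A(z, w) is shifted because it starts at P i k in A(i, k). *)
Definition act_right i j k x :=
  if x < C i j then x
  else if (P i j <= x) && (x + C i j < P i j + Q i j) then x - P i j + P i k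
  else 0.

Definition comp_nonid i j k x y :=
  if sim i j then
    if sim j k then fst_code i j x * P j k + snd_code j k y
    else act_left j k y
  else if sim j k then act_right i j k x else 0.

(** The only endomorphism of a base object has code 0, which represents the pair
    of identities. Its composition law is already neutral, so only the other
    identities need a code of their own, the first one beyond the pairs. *)
Definition is_id i j x := [&& i == j, ~~ base i & x == Q i i * P i i].

Definition comp_code i j k x y :=
  if is_id i j x then y else if is_id j k y then x else comp_nonid i j k x y.

Definition id_code i := if base i then 0 else Q i i * P i i.

Lemma fst_code_lt i j x : sim i j -> fst_code i j x < Q i j.
Proof.
move=> ij; have [P0 Q0] := sim_gt0 ij; rewrite /fst_code.
by case: ifP => // xQP; rewrite ltn_divLR.
Qed.

Lemma snd_code_lt i j x : sim i j -> snd_code i j x < P i j.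
Proof.
move=> ij; have [P0 _] := sim_gt0 ij; rewrite /snd_code.
by case: ifP => // xQP; rewrite ltn_mod.
Qed.

Lemma pair_code_lt (q p f g : nat) : f < q -> g < p -> f * p + g < q * p.
Proof. nia. Qed.

Lemma fst_code_pair i j f g :
  f < Q i j -> g < P i j -> fst_code i j (f * P i j + g) = f.
Proof.
move=> fQ gP; rewrite /fst_code pair_code_lt // divnMDl ?divn_small ?addn0 //.
exact: leq_ltn_trans gP.
Qed.

Lemma snd_code_pair i j f g :
  f < Q i j -> g < P i j -> snd_code i j (f * P i j + g) = g.
Proof. by move=> fQ gP; rewrite /snd_code pair_code_lt // modnMDl modn_small. Qed.

Lemma act_left_lt j k y : 0 < M j k -> ~~ sim j k -> act_left j k y < P j k.
Proof.
move=> Mjk jk; have [C0 CP _ _] := strict_le Mjk jk.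
by rewrite /act_left; case: ifP => // _; apply: leq_trans CP.
Qed.

(** Composites of non-identities inside a class are pairs, so they have smaller
    codes than an identity; this keeps them apart in [comp_nonid_nonid]. *)
Lemma comp_nonid_lt i j k x y : 0 < M i j -> 0 < M j k ->
  comp_nonid i j k x y < if sim i k then Q i k * P i k else M i k.
Proof.
move=> Mij Mjk; have ik := index_sim_comp accM Mij Mjk; rewrite /comp_nonid ik.
have Mik := M_trans accM Mij Mjk.
have [ij|nij] := boolP (sim i j); have [jk|njk] := boolP (sim j k) => //=.
- rewrite (simP k ij) -(simQ i jk).
  by rewrite pair_code_lt ?fst_code_lt ?snd_code_lt.
- apply: (leq_trans (act_left_lt y Mjk njk)).
  have [] := @strict_le i k Mik; rewrite ?ik ?(negPf njk) ?andbF //.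
  by rewrite -(simP k ij); lia.
have [] := @strict_le i k Mik; rewrite ?ik ?(negPf nij) //.
rewrite -(simQ i jk) -(simC2 i jk) => C0 CP CQ PQ.
by rewrite /act_right; repeat case: ifP; lia.
Qed.

Lemma comp_nonid_nonid i j k x y : 0 < M i j -> 0 < M j k ->
  is_id i k (comp_nonid i j k x y) = false.
Proof.
move=> Mij Mjk; have := comp_nonid_lt x y Mij Mjk.
rewrite /is_id; case: eqP => // <-; rewrite (index_sim_refl accM) => lt.
by rewrite (ltn_eqF lt) andbF.
Qed.

Lemma comp_code_lt i j k x y :
  x < M i j -> y < M j k -> comp_code i j k x y < M i k.
Proof.
move=> xM yM; rewrite /comp_code; case: ifP => [/andP[/eqP-> _] //|_].
case: ifP => [/andP[/eqP<- _] //|_].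
have Mij : 0 < M i j by lia.
have Mjk : 0 < M j k by lia.
apply: leq_trans (comp_nonid_lt x y Mij Mjk) _.
by case: ifP => // /sim_le.
Qed.

Lemma id_code_lt i : id_code i < M i i.
Proof.
by rewrite /id_code; case: (boolP (base i)) => [/base1 ->|/nbase_lt].
Qed.

Lemma is_id_code i : ~~ base i -> is_id i i (id_code i).
Proof. by move=> bi; rewrite /is_id /id_code (negPf bi) !eqxx. Qed.

Lemma comp_code_idl i k y : y < M i k -> comp_code i i k (id_code i) y = y.
Proof.
move=> yM; rewrite /comp_code.
have [bi|/is_id_code->//] := boolP (base i).
rewrite {1}/is_id bi /= andbF; case: ifP => [/and3P[/eqP ik]|_].
  by rewrite bi.
rewrite /id_code bi /comp_nonid (index_sim_refl accM).
case: ifP => [ik|_]; last by rewrite /act_left baseP // yM.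
rewrite /fst_code /snd_code div0n if_same mul0n add0n -(simQ i ik) baseQ //.
by rewrite base1 // mul1n baseP // yM modn_small.
Qed.

Lemma comp_code_idr i j x : x < M i j -> comp_code i j j x (id_code j) = x.
Proof.
move=> xM; rewrite /comp_code.
case: ifP => [/and3P[/eqP <- nb /eqP ->]|_]; first by rewrite /id_code (negPf nb).
have [bj|/is_id_code->//] := boolP (base j).
rewrite {1}/is_id bj /= andbF.
rewrite /id_code bj /comp_nonid (index_sim_refl accM).
case: ifP => [ij|_].
  rewrite /fst_code /snd_code mod0n if_same addn0 (simP j ij).
  rewrite baseP // baseQ // base1 //.
  by rewrite !muln1 xM divn1.
by rewrite /act_right baseC // baseQ //; repeat case: ifP; lia.
Qed.

(** Except in one case, both sides agree because the outer factors alone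
    determine a pair, because a retraction is idempotent, or because both are 0,
    which every retraction fixes. When only the middle morphism changes
    class, the equality is the commutation of the two retractions. *)
Lemma comp_nonidA i j k l x y w : 0 < M i j -> 0 < M j k -> 0 < M k l ->
  comp_nonid i j l x (comp_nonid j k l y w) =
  comp_nonid i k l (comp_nonid i j k x y) w.
Proof.
move=> Mij Mjk Mkl; rewrite {1 3}/comp_nonid.
have Mik := M_trans accM Mij Mjk; have Mjl := M_trans accM Mjk Mkl.
rewrite (index_sim_comp accM Mij Mjk) (index_sim_comp accM Mjk Mkl) /comp_nonid.
have [ij|nij] := boolP (sim i j); have [jk|njk] := boolP (sim j k);
have [kl|nkl] := boolP (sim k l) => //=.
- rewrite -(simP l jk) snd_code_pair; first 1 last.
  + by rewrite -(simQ j kl) fst_code_lt.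
  + by rewrite (simP l jk) snd_code_lt.
  rewrite -(simP k ij) fst_code_pair //.
    by rewrite -(simQ i jk) fst_code_lt.
  by rewrite (simP k ij) snd_code_lt.
- have [C0 CP _ _] := strict_le Mkl nkl.
  rewrite /act_left (simP l jk); repeat case: ifP; lia.
- have njl : ~~ sim j l by rewrite (index_sim_comp accM Mjk Mkl) (negPf njk).
  have [] := strict_le Mjk njk; have [] := strict_le Mjl njl.
  rewrite /act_left /act_right -(simC2 j kl) -(simQ j kl).
  rewrite -!(simP _ ij) -(simC1 k ij).
  move=> ? ? ? ? ? ? ? ?.
  repeat case: ifP; lia.
- by rewrite /act_left if_same.
- have nik : ~~ sim i k by rewrite (index_sim_comp accM Mij Mjk) (negPf nij).
  have [] := strict_le Mij nij; have [] := strict_le Mik nik.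
  rewrite /act_right -(simC2 i jk) -(simQ i jk).
  move=> ? ? ? ? ? ? ? ?.
  repeat case: ifP; lia.
- have nik : ~~ sim i k by rewrite (index_sim_comp accM Mij Mjk) (negPf nij).
  by have [C0 _ _ _] := strict_le Mik nik; rewrite /act_right C0.
Qed.

Lemma comp_codeA i j k l x y w : x < M i j -> y < M j k -> w < M k l ->
  comp_code i j l x (comp_code j k l y w) =
  comp_code i k l (comp_code i j k x y) w.
Proof.
move=> xM yM wM.
have gt0 u v : u < v -> 0 < v := leq_ltn_trans (leq0n u).
have [Mij Mjk Mkl] := And3 (gt0 _ _ xM) (gt0 _ _ yM) (gt0 _ _ wM).
case idx: (is_id i j x).
  by case/andP: (idx) => /eqP ij _; subst j; rewrite /comp_code idx.
case idy: (is_id j k y).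
  by case/andP: (idy) => /eqP jk _; subst k; rewrite /comp_code idx idy idx.
have xyE : comp_code i j k x y = comp_nonid i j k x y.
  by rewrite /comp_code idx idy.
case idw: (is_id k l w).
  case/andP: (idw) => /eqP kl _; subst l.
  by rewrite xyE /comp_code idx idy idw /= ?idx ?idy comp_nonid_nonid.
rewrite xyE /comp_code idx idy idw !comp_nonid_nonid //.
exact: comp_nonidA.
Qed.

Lemma mxcat_of_codes : inhabited (mxcat M).
Proof.
constructor; apply: (@Mxcat _ _ (fun i => Ordinal (id_code_lt i))
  (fun i j k x y => Ordinal (comp_code_lt (ltn_ord x) (ltn_ord y)))).
- by move=> i j f; apply: val_inj; apply: comp_code_idl (ltn_ord f).
- by move=> i j f; apply: val_inj; apply: comp_code_idr (ltn_ord f).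
- move=> i j k l f g h; apply: val_inj.
  exact: comp_codeA (ltn_ord f) (ltn_ord g) (ltn_ord h).
Qed.
End Sufficiency.

(** * Sufficiency of the inequalities *)

Section FromInequalities.
Variables (n : nat) (M : 'M[nat]_n).
Local Notation sim := (index_sim M).
Local Notation class_of := (class_of M).

Hypothesis accM : acceptable M.

Variable z : mclass M -> 'I_n.
Hypothesis hz : base_points z.

Hypothesis diag_ineq :
  forall (l : mclass M) (i : 'I_n), typeU l -> i \in sval l -> i <> z l ->
  a z l i * b z l i + 1 <= M i i.
Hypothesis class_ineq :
  forall (l : mclass M) (i j : 'I_n), typeU l ->
  i \in sval l -> j \in sval l -> a z l i * b z l j <= M i j.
Hypothesis col_ineq :
  forall (l m : mclass M) (i j : 'I_n), class_gt l m -> typeU m ->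
  i \in sval l -> j \in sval m -> M i (z m) <= M i j.
Hypothesis row_ineq :
  forall (l m : mclass M) (i j : 'I_n), class_gt l m -> typeU l ->
  i \in sval l -> j \in sval m -> M (z l) j <= M i j.
Hypothesis union_ineq :
  forall (l m : mclass M) (i j : 'I_n), class_ge l m ->
  typeU l -> typeU m -> i \in sval l -> j \in sval m ->
  ((M (z l) j)%:Z + (M i (z m))%:Z - (M (z l) (z m))%:Z <= (M i j)%:Z)%R.

Definition indexU i := typeU (class_of i).
Definition base_index i := z (class_of i).
Definition is_base i := indexU i && (i == base_index i).
(** The default value 1 is the number of morphisms to or from the virtual base
    object of a class of type V. *)
Definition row_size i j := if indexU i then M (base_index i) j else 1.
Definition col_size i j := if indexU j then M i (base_index j) else 1.
Definition corner_size i j :=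
  if indexU i && indexU j then M (base_index i) (base_index j) else 1.

Lemma sim_base_index i : indexU i -> sim i (base_index i).
Proof. by move=> /hz[]; rewrite mem_class_of. Qed.

Lemma base_index1 i : indexU i -> M (base_index i) (base_index i) = 1.
Proof. by move=> /hz[]. Qed.

Lemma strict_class_gt i j :
  0 < M i j -> ~~ sim i j -> class_gt (class_of i) (class_of j).
Proof.
move=> Mij nij; have sim_refl := index_sim_refl accM.
split; first by exists i, j; rewrite !mem_class_of.
move=> E; case/negP: nij; have := @mem_class_of _ M i j.
by rewrite E mem_class_of => <-.
Qed.

(** When exactly one of the two classes is of type V, the virtual base object
    turns the bound on the union into the column or the row inequality, and into
    1 <= M i j when both are. *)
Lemma strict_code_room i j : 0 < M i j -> ~~ sim i j ->
  [/\ 0 < corner_size i j, corner_size i j <= row_size i j,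
      corner_size i j <= col_size i j &
      row_size i j + col_size i j <= M i j + corner_size i j].
Proof.
move=> Mij nij; have gt := strict_class_gt Mij nij.
have sim_refl := index_sim_refl accM.
have ii : i \in sval (class_of i) by rewrite mem_class_of.
have jj : j \in sval (class_of j) by rewrite mem_class_of.
rewrite /corner_size /row_size /col_size.
case Ui: (indexU i); case Uj: (indexU j) => //=.
- have /andP[_ Mzi] := sim_base_index Ui.
  have /andP[Mjz _] := sim_base_index Uj.
  have zi : base_index i \in sval (class_of i).
    by rewrite mem_class_of sim_base_index.
  have zj : base_index j \in sval (class_of j).
    by rewrite mem_class_of sim_base_index.
  split.
  + exact: accM.2 Mzi (accM.2 _ _ _ Mij Mjz).
  + exact: col_ineq gt Uj zi jj.
  + exact: row_ineq gt Ui ii zj.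
  + by have := union_ineq gt.1 Ui Uj ii jj; rewrite -!/(base_index _); lia.
- have /andP[_ Mzi] := sim_base_index Ui.
  split=> //; first exact: accM.2 Mzi Mij.
  by rewrite leq_add2r; exact: row_ineq gt Ui ii jj.
- have /andP[Mjz _] := sim_base_index Uj.
  split=> //; first exact: accM.2 Mij Mjz.
  by rewrite addnC leq_add2r; exact: col_ineq gt Uj ii jj.
- by rewrite leq_add2r.
Qed.

Lemma mxcat_of_ineqs : inhabited (mxcat M).
Proof.
have sim_refl := index_sim_refl accM.
apply: (@mxcat_of_codes _ _ is_base row_size col_size corner_size) => //.
- by move=> i j k ij; rewrite /row_size /indexU /base_index (class_of_sim accM ij).
- by move=> i j k jk; rewrite /col_size /indexU /base_index (class_of_sim accM jk).
- by move=> i j k ij; rewrite /corner_size /indexU /base_index (class_of_sim accM ij).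
- by move=> i j k jk; rewrite /corner_size /indexU /base_index (class_of_sim accM jk).
- by move=> i /andP[Ui /eqP ->]; apply: base_index1.
- by move=> i k /andP[Ui /eqP E]; rewrite /row_size Ui -E.
- by move=> i k /andP[Uk /eqP E]; rewrite /col_size Uk -E.
- by move=> i k /andP[Uk /eqP E]; rewrite /corner_size /row_size Uk andbT -E.
- move=> i j ij; rewrite /row_size /col_size.
  case/andP: (ij) => Mij _; split; case: ifP => // U.
    have /andP[_ Mzi] := sim_base_index U; exact: accM.2 Mzi Mij.
  have /andP[Mjz _] := sim_base_index U; exact: accM.2 Mij Mjz.
- move=> i j ij; rewrite /row_size /col_size /indexU /base_index.
  rewrite -(class_of_sim accM ij); case: ifP => U; last by case/andP: ij.
  by apply: class_ineq U _ _; rewrite mem_class_of.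
- move=> i; rewrite /is_base /row_size /col_size negb_and.
  case Ui: (indexU i) => /= nbi.
    have /eqP ni := nbi.
    by have := diag_ineq Ui _ ni; rewrite mem_class_of addn1; apply.
  have Mii : 0 < M i i by apply: accM.1.
  rewrite ltn_neqAle Mii andbT; apply: contraFneq Ui => Mii1.
  by apply/existsP; exists i; rewrite mem_class_of sim_refl -Mii1 eqxx.
- exact: strict_code_room.
Qed.
End FromInequalities.

Theorem mainTheorem1 (n : nat) (M : 'M[nat]_n) (hM : reduced M)
    (z : mclass M -> 'I_n) (hz : base_points z) :
  Cat_nonempty M <->
  acceptable M /\
  [/\ forall (l : mclass M) (i : 'I_n), typeU l -> i \in sval l -> i <> z l ->
        a z l i * b z l i + 1 <= M i i,
      forall (l : mclass M) (i j : 'I_n), typeU l ->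
        i \in sval l -> j \in sval l ->
        a z l i * b z l j <= M i j,
      forall (l m : mclass M) (i j : 'I_n), class_gt l m -> typeU m ->
        i \in sval l -> j \in sval m ->
        M i (z m) <= M i j,
      forall (l m : mclass M) (i j : 'I_n), class_gt l m -> typeU l ->
        i \in sval l -> j \in sval m ->
        M (z l) j <= M i j
    & forall (l m : mclass M) (i j : 'I_n), class_ge l m ->
        typeU l -> typeU m -> i \in sval l -> j \in sval m ->
        ((M (z l) j)%:Z + (M i (z m))%:Z - (M (z l) (z m))%:Z
           <= (M i j)%:Z)%R].
Proof.
rewrite Cat_nonempty_mxcat; split=> [[A]|[accM [c1 c2 c3 c4 c5]]]; last first.
  exact: (mxcat_of_ineqs accM hz).
have accM := mxcat_acceptable A.
have simz l i : typeU l -> i \in sval l -> index_sim M (z l) i.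
  by move=> /hz[zl _]; apply: (sim_in_class accM zl).
have rz l i : typeU l -> i \in sval l -> retract A (z l) i.
  by move=> Ul il; apply: endo1_retract; [case: (hz l Ul) | exact: simz].
split=> //; split.
- move=> l i Ul il iz; apply: (factor_count_endo A hM iz); last exact: simz.
  by case: (hz l Ul).
- move=> l i j Ul il jl; apply: (factor_count A); try exact: simz.
  by case: (hz l Ul).
- by move=> l m i j _ Um _ jm; apply: retract_col (rz m j Um jm).
- by move=> l m i j _ Ul il _; apply: retract_row (rz l i Ul il).
- move=> l m i j _ Ul Um il jm.
  by have := retract_union_count (rz l i Ul il) (rz m j Um jm); lia.
Qed.
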